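(* Let $p = 3$ and let $q > 3$ be a prime number. Then the energy of the line graph $L(\Gamma(\mathbb{Z}_{3q}))$ is $4q-p-5$.
   Context: For a positive integer $n$, $\mathbb{Z}_n$ is the ring of residue classes modulo $n$. The zero-divisor graph $\Gamma(\mathbb{Z}_n)$ is the simple undirected graph whose vertices are the nonzero zero-divisors of $\mathbb{Z}_n$ (nonzero $x \in \mathbb{Z}_n$ such that $xy = 0$ for some nonzero $y \in \mathbb{Z}_n$), with distinct vertices $x,y$ adjacent if and only if $xy=0$. The line graph $L(\Gamma(\mathbb{Z}_n))$ is the graph whose vertices are the edges of $\Gamma(\mathbb{Z}_n)$, two distinct vertices being adjacent if the corresponding edges share a common vertex in $\Gamma(\mathbb{Z}_n)$. The energy of a finite graph is the sum of the absolute values of the eigenvalues (counted with multiplicity) of its adjacency matrix. *)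

(* Defs.v *)
From HB Require Import structures.
From mathcomp Require Import all_boot all_order all_algebra all_field.

Set Implicit Arguments.
Unset Strict Implicit.
Unset Printing Implicit Defensive.

Import GRing.Theory.
Local Open Scope ring_scope.

Record sgraph := SGraph {
  vertex : finType;
  adj : rel vertex;
  adj_sym : symmetric adj;
  adj_irrefl : irreflexive adj
}.

Definition adjacency_mx (G : sgraph) : 'M[algC]_#|vertex G| :=
  \matrix_(i, j) (adj (enum_val i) (enum_val j))%:R.

(* Eigenvalues listed with algebraic multiplicity: the roots in algC of the
   (monic) characteristic polynomial.  No eigenvalue is lost by working in
   algC, since the adjacency matrix has integer entries. *)
Definition spectrum (G : sgraph) : seq algC :=
  sval (closed_field_poly_normal (char_poly (adjacency_mx G))).

Definition energy (G : sgraph) : algC := \sum_(x <- spectrum G) `|x|.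

Section ZeroDivisorGraph.

Variable R : finComNzRingType.

Definition nz_zero_divisor (x : R) : bool :=
  (x != 0) && [exists y : R, (y != 0) && (x * y == 0)].

Definition zdiv_vertex : finType := {x : R | nz_zero_divisor x}.

Definition zdiv_adj : rel zdiv_vertex :=
  fun x y => (x != y) && (val x * val y == 0).

Lemma zdiv_adj_sym : symmetric zdiv_adj.
Proof. by move=> x y; rewrite /zdiv_adj eq_sym mulrC. Qed.

Lemma zdiv_adj_irrefl : irreflexive zdiv_adj.
Proof. by move=> x; rewrite /zdiv_adj eqxx. Qed.

Definition zero_divisor_graph : sgraph := SGraph zdiv_adj_sym zdiv_adj_irrefl.

End ZeroDivisorGraph.

Section LineGraph.

Variable G : sgraph.

Definition is_edge (e : {set vertex G}) : bool :=
  [exists x, exists y, adj x y && (e == [set x; y])].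

Definition edge : finType := {e : {set vertex G} | is_edge e}.

Definition line_adj : rel edge :=
  fun e f => (e != f) && (val e :&: val f != set0).

Lemma line_adj_sym : symmetric line_adj.
Proof. by move=> e f; rewrite /line_adj eq_sym setIC. Qed.

Lemma line_adj_irrefl : irreflexive line_adj.
Proof. by move=> e; rewrite /line_adj eqxx. Qed.

Definition line_graph : sgraph := SGraph line_adj_sym line_adj_irrefl.

End LineGraph.

(* Main.v *)
Require Import Defs.
From mathcomp Require Import all_boot all_order all_algebra all_field.
From mathcomp Require Import all_fingroup.
From mathcomp Require Import ring zify.

Import GRing.Theory Num.Theory.
Local Open Scope ring_scope.

(** The zero divisors of Z/3q split into the two multiples of q and the q-1
    multiples of 3, and two of them have product 0 exactly when they lie on
    different sides: the graph is the complete bipartite graph K_{2,q-1}.  Its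
    line graph is the Cartesian product of K_2 and K_{q-1}, whose adjacency
    matrix is [[J - 1, 1], [1, J - 1]] with J the all-ones matrix.  The
    characteristic polynomial is thus the product of those of J and J - 2, so
    the eigenvalues are q-1, q-3, and 0 and -2 with multiplicity q-2, and the
    energy is (q-1) + (q-3) + 2(q-2) = 4q - 8. *)

(** Adding the second block row to the first, then subtracting the first block column from the
    second, makes the matrix block lower triangular. *)
Lemma det_block_swap (R : comNzRingType) (n : nat) (A B : 'M[R]_n) :
  \det (block_mx A B B A) = \det (A + B) * \det (A - B).
Proof.
have E : block_mx 1%:M 1%:M 0 1%:M *m block_mx A B B A *m
         block_mx 1%:M (- 1%:M) 0 1%:M = block_mx (A + B) 0 B (A - B).
  rewrite !mulmx_block !mul1mx !mul0mx !mulmx1 !mulmx0 !mulmxN !mulmx1 !add0r !addr0.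
  by rewrite [B + A]addrC addNr [- B + A]addrC.
by move/(congr1 determinant): E; rewrite !det_mulmx !det_ublock !det1 !mul1r !mulr1 det_lblock.
Qed.

(* Multiply [[1, v], [u, x]] on the left by [[1, 0], [- u, 1]] and on the right
   by [[x, 0], [- u, 1]]; the extra factor [x] avoids dividing in [R]. *)
Lemma det_scalar_sub_rank1 (R : comNzRingType) (n : nat) (x : R)
    (u : 'cV[R]_n) (v : 'rV[R]_n) :
  x * \det (x%:M - u *m v) = (x - (v *m u) 0 0) * x ^+ n.
Proof.
pose M := block_mx 1%:M v u x%:M.
have EL : block_mx 1%:M 0 (- u) 1%:M *m M = block_mx 1%:M v 0 (x%:M - u *m v).
  rewrite mulmx_block !mul1mx !mul0mx !addr0 !mulmx1 addNr.
  by rewrite mulNmx addrC.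
have ER : M *m block_mx x%:M 0 (- u) 1%:M =
    block_mx (x%:M - v *m u) v 0 x%:M.
  rewrite mulmx_block !mul1mx !mulmx0 !add0r !mulmx1 !mulmxN.
  by rewrite mul_mx_scalar mul_scalar_mx subrr.
have dL : \det M = \det (x%:M - u *m v).
  by move/(congr1 determinant): EL; rewrite det_mulmx det_lblock det_ublock !det1 !mul1r.
move/(congr1 determinant): ER.
by rewrite det_mulmx det_lblock det_ublock !det1 mulr1 !det_scalar det_mx11 !mxE expr1 dL mulrC => <-.
Qed.

(** A bijective reindexing permutes rows and columns alike, so the sign of the permutation occurs
    twice and cancels. Keeping [m] and [n] apart allows the size [#|vertex G|] to be traded for an
    explicit one. *)
Lemma char_poly_mxsub (R : comNzRingType) (m n : nat) (f : 'I_m -> 'I_n)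
    (A : 'M[R]_n) :
  bijective f -> char_poly (mxsub f f A) = char_poly A.
Proof.
move=> bij_f; have eq_mn : m = n by rewrite -(card_ord m) (bij_eq_card bij_f) card_ord.
subst n; have inj_f := bij_inj bij_f.
have -> : char_poly (mxsub f f A) = \det (row_perm (perm inj_f) (col_perm (perm inj_f) (char_poly_mx A))).
  by congr (\det _); apply/matrixP => i j; rewrite !mxE !permE (inj_eq inj_f).
rewrite row_permE col_permE !det_mulmx !det_perm odd_permV mulrCA.
by rewrite -signr_addb addbb mulr1.
Qed.

Lemma char_poly_block_swap (R : comNzRingType) (n : nat) (A B : 'M[R]_n) :
  char_poly (block_mx A B B A) = char_poly (A + B) * char_poly (A - B).
Proof.
rewrite /char_poly /char_poly_mx map_block_mx scalar_mx_block opp_block_mx add_block_mx.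
by rewrite !add0r det_block_swap map_mxB map_mxD !opprD !addrA.
Qed.

Lemma char_poly_const_add_scalar (R : idomainType) (n : nat) (c : R) :
  char_poly (const_mx 1 + c%:M : 'M[R]_n.+1) =
  ('X - (c + n.+1%:R)%:P) * ('X - c%:P) ^+ n.
Proof.
(* The extra factor ['X - c%:P] prepares for [det_scalar_sub_rank1], since the all-ones matrix has
   rank one; it cancels over an integral domain. *)
apply: (mulfI (negbT (polyXsubC_eq0 c))).
pose u : 'cV[{poly R}]_n.+1 := const_mx 1; pose v : 'rV[{poly R}]_n.+1 := const_mx 1.
have uvE : u *m v = const_mx 1.
  by apply/matrixP => i j; rewrite !mxE big_ord1 !mxE mulr1.
have vuE : (v *m u) 0 0 = n.+1%:R.
  rewrite mxE (eq_bigr (fun=> 1)) => [|i _]; last by rewrite !mxE mulr1.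
  by rewrite sumr_const card_ord.
have -> : char_poly (const_mx 1 + c%:M : 'M[R]_n.+1) = \det (('X - c%:P)%:M - u *m v).
  rewrite uvE; congr (\det _); apply/matrixP => i j; rewrite !mxE.
  by rewrite mulrnBl polyCD polyC1 polyCMn opprD addrA addrAC.
rewrite det_scalar_sub_rank1 vuE exprS polyCD polyC_natr opprD addrA.
by rewrite mulrCA.
Qed.

(** Factorization into monic linear factors is unique up to order, so any list of roots can replace
    the one chosen in [spectrum]. *)
Lemma sum_norm_spectrum (G : sgraph) (s : seq algC) :
  char_poly (adjacency_mx G) = \prod_(x <- s) ('X - x%:P) ->
  energy G = \sum_(x <- s) `|x|.
Proof.
rewrite /energy /spectrum; case: closed_field_poly_normal => r /= Er Es.
apply: perm_big; apply: prod_XsubC_eq; rewrite -Es Er.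
by rewrite (monicP (char_poly_monic _)) scale1r.
Qed.

Lemma char_poly_adjacency (G : sgraph) (n : nat) (f : 'I_n -> vertex G) :
  bijective f ->
  char_poly (adjacency_mx G) = char_poly (\matrix_(i, j) (adj (f i) (f j))%:R : 'M[algC]_n).
Proof.
move=> bij_f; rewrite -(@char_poly_mxsub _ _ _ (enum_rank \o f)).
  by congr char_poly; apply/matrixP => i j; rewrite !mxE /= !enum_rankK.
exact: bij_comp (enum_rank_bij _) bij_f.
Qed.

(* The hypotheses describe the Cartesian product of [K_2] and [K_(m+2)]; its
   eigenvalues are [m+2], [m], and [0] and [-2] with multiplicity [m+1]. *)
Lemma energy_prism (G : sgraph) (m : nat) (f : 'I_m.+2 + 'I_m.+2 -> vertex G) :
  bijective f ->
  (forall i j, adj (f (inl i)) (f (inl j)) = (i != j)) ->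
  (forall i j, adj (f (inr i)) (f (inr j)) = (i != j)) ->
  (forall i j, adj (f (inl i)) (f (inr j)) = (i == j)) ->
  energy G = 4 * m.+1%:R.
Proof.
move=> bij_f adjl adjr adjlr.
pose g := f \o @split m.+2 m.+2.
have bij_g : bijective g.
  by apply: bij_comp bij_f _; exists unsplit; [exact: splitK | exact: unsplitK].
have AE : \matrix_(i, j) (adj (g i) (g j))%:R =
    block_mx (const_mx 1 - 1%:M) 1%:M 1%:M (const_mx 1 - 1%:M) :> 'M[algC]_(m.+2 + m.+2).
  apply/matrixP => i j; rewrite mxE /g /= -[i in RHS]splitK -[j in RHS]splitK.
  case: (split i) => {}i; case: (split j) => {}j.
  - by rewrite block_mxEul !mxE adjl; case: eqP; rewrite ?subrr ?subr0.
  - by rewrite block_mxEur !mxE adjlr.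
  - by rewrite block_mxEdl !mxE adj_sym adjlr eq_sym.
  - by rewrite block_mxEdr !mxE adjr; case: eqP; rewrite ?subrr ?subr0.
pose s : seq algC := m.+2%:R :: m%:R :: nseq m.+1 0 ++ nseq m.+1 (- 2).
rewrite (@sum_norm_spectrum _ s).
  rewrite !big_cons big_cat !big_nseq normr0 normrN !normr_nat !iter_addr_0.
  rewrite /= mul0rn !add0r -[X in _ + (_ + X)]mulr_natr -[m.+2%:R]natr1 -[m.+1%:R]natr1; ring.
rewrite (char_poly_adjacency _ _ _ bij_g) AE char_poly_block_swap.
(* The summand [0%:M] lets [char_poly_const_add_scalar] handle both factors, with [c = 0] here and
   [c = - 2] next. *)
have -> : const_mx 1 - 1%:M + 1%:M = const_mx 1 + 0%:M :> 'M[algC]_m.+2.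
  by rewrite subrK raddf0 addr0.
have -> : const_mx 1 - 1%:M - 1%:M = const_mx 1 + (- 2)%:M :> 'M[algC]_m.+2.
  by rewrite -addrA -opprD -raddfD raddfN.
rewrite !char_poly_const_add_scalar !big_cons big_cat !big_nseq.
rewrite add0r.
have -> : - 2 + m.+2%:R = m%:R :> algC by rewrite -addn2 natrD; ring.
by rewrite !iter_mulr_1 /= -mulrA; congr (_ * _); rewrite mulrCA exprS -!mulrA.
Qed.

(** The edges through each of the two vertices of [S] form a clique in the line graph, and edges
    from different cliques meet exactly when their ends outside [S] coincide. This is the pattern of
    [energy_prism]. *)
Lemma energy_line_graph_K2 (G : sgraph) (S : {set vertex G}) (m : nat) :
  #|S| = 2%N -> #|~: S| = m.+2 ->
  (forall x y, adj x y = (x \in S) (+) (y \in S)) ->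
  energy (line_graph G) = 4 * m.+1%:R.
Proof.
move=> /eqP/cards2P[a [b [ab SE]]] cardT adjE.
have inSP x : reflect (x = a \/ x = b) (x \in S) by rewrite SE; exact: set2P.
have aS : a \in S by apply/inSP; left.
have bS : b \in S by apply/inSP; right.
pose t i : vertex G := enum_val (cast_ord (esym cardT) i).
have tNS i : t i \notin S by have := enum_valP (cast_ord (esym cardT) i); rewrite inE.
have inj_t : injective t by move=> i j /enum_val_inj/cast_ord_inj.
have t_onto y : y \notin S -> exists i, y = t i.
  rewrite -in_setC => yT; exists (cast_ord cardT (enum_rank_in yT y)).
  by rewrite /t cast_ordK enum_rankK_in.
have neS x i : x \in S -> (x == t i) = false.
  by move=> xS; apply/eqP => xt; move: (tNS i); rewrite -xt xS.
have edgeP x i : x \in S -> is_edge [set x; t i].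
  move=> xS; apply/existsP; exists x; apply/existsP; exists (t i).
  by rewrite adjE xS (negPf (tNS i)) eqxx.
pose f (u : 'I_m.+2 + 'I_m.+2) : edge G :=
  match u with
  | inl i => exist _ [set a; t i] (edgeP a i aS)
  | inr i => exist _ [set b; t i] (edgeP b i bS)
  end.
have meetE x y i j : x \in S -> y \in S ->
    ([set x; t i] :&: [set y; t j] != set0) = (x == y) || (i == j).
  move=> xS yS; apply/set0Pn/orP => [[z]|[/eqP<-|/eqP<-]].
  - rewrite !inE => /andP[/orP[]/eqP-> /orP[]].
    + by left.
    + by rewrite neS.
    + by rewrite eq_sym neS.
    + by rewrite (inj_eq inj_t); right.
  - by exists x; rewrite !inE eqxx.
  - by exists (t i); rewrite !inE eqxx !orbT.
have eqE x y i j : x \in S -> y \in S ->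
    ([set x; t i] == [set y; t j]) = (x == y) && (i == j).
  move=> xS yS; apply/eqP/andP => [E|[/eqP-> /eqP->] //].
  have: x \in [set y; t j] by rewrite -E set21.
  have: t i \in [set y; t j] by rewrite -E set22.
  by rewrite !inE (neS x) // orbF eq_sym (neS y) //= (inj_eq inj_t).
have fadj u v : line_adj (f u) (f v) =
    (val (f u) != val (f v)) && (val (f u) :&: val (f v) != set0).
  by rewrite /line_adj val_eqE.
apply: (@energy_prism (line_graph G) m f).
- have inj_f : injective f.
    move=> [] i [] j /(congr1 val) /eqP /=; rewrite eqE //.
    + by rewrite eqxx => /eqP->.
    + by rewrite (negPf ab).
    + by rewrite eq_sym (negPf ab).
    + by rewrite eqxx => /eqP->.
  have onto_f e : e \in codom f.
    case: e => e pe; have /existsP[x /existsP[y /andP[]]] := pe; rewrite adjE.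
    (* Exactly one end of an edge lies in [S]; the ends are exchanged if it is [y]. *)
    wlog xS : x y / x \in S => [wl|].
      case: (boolP (x \in S)) => xS; first by move=> yS; apply: (wl x y); rewrite ?xS.
      by move=> /= yS eE; apply: (wl y x) => //; rewrite 1?addbC ?(negPf xS) ?[[set y; x]]setUC.
    rewrite xS => /t_onto[i ->] /eqP eE; apply/codomP.
    by case/inSP: (xS) => xE; [exists (inl i)|exists (inr i)]; apply: val_inj; rewrite /= eE xE.
  apply: (inj_card_bij inj_f); rewrite -(card_codom inj_f).
  by apply: subset_leq_card; apply/subsetP => e _.
- by move=> i j; rewrite [LHS]fadj /= meetE // eqE // eqxx andbT.
- by move=> i j; rewrite [LHS]fadj /= meetE // eqE // eqxx andbT.
- by move=> i j; rewrite [LHS]fadj /= meetE // eqE // (negPf ab).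
Qed.

(** The elements counted are [d], [2d], ..., [(e-1)d], all annihilated by the nonzero class of [e].
    The shift [i.+1] in [h] leaves out 0. *)
Lemma card_zero_divisor_multiples (d e : nat) :
  (1 < d)%N -> (1 < e)%N ->
  #|[set x : vertex (zero_divisor_graph 'Z_(d * e)) | (d %| val x)%N]| = e.-1.
Proof.
move=> d1 e1; have n1 : (1 < d * e)%N by rewrite -[1%N]muln1; apply: ltn_mul.
have d0 := ltnW d1; have ZE := Zp_cast n1.
pose h (i : 'I_e.-1) : 'Z_(d * e) := (d * i.+1)%:R.
have hE i : h i = (d * i.+1)%N :> nat.
  rewrite val_Zp_nat // modn_small // ltn_pmul2l //.
  by case: i => i /= ; rewrite -ltnS prednK // ltnW.
have inj_h : injective h.
  move=> i j /(congr1 (@nat_of_ord _)); rewrite !hE => /eqP.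
  by rewrite eqn_pmul2l // => /eqP[] /val_inj.
rewrite -(card_imset _ val_inj) -[RHS]card_ord -(card_imset _ inj_h).
apply: eq_card => z; apply/imsetP/imsetP => [[x] | [i _ ->]].
  rewrite inE => dx ->; case: x dx => x /= /andP[x0 _] /dvdnP[k xk].
  have xn : (x < d * e)%N by rewrite -[X in (_ < X)%N]ZE.
  have k0 : (0 < k)%N
    by rewrite lt0n; apply: contra x0 => /eqP k0; apply/eqP/val_inj; rewrite /= xk k0.
  have ke : (k.-1 < e.-1)%N by move: xn; rewrite xk mulnC ltn_pmul2l //; lia.
  by exists (Ordinal ke) => //; apply: val_inj; rewrite /= hE /= xk prednK // mulnC.
have hz : nz_zero_divisor (h i).
  have nz (y : 'Z_(d * e)) : (0 < y)%N -> y != 0.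
    by apply: contraTneq => ->.
  apply/andP; split; first by apply: nz; rewrite hE muln_gt0 d0.
  apply/existsP; exists e%:R; apply/andP; split.
    by apply: nz; rewrite val_Zp_nat // modn_small ?ltn_Pmull //; lia.
  rewrite -natrM; apply/eqP/val_inj; rewrite /= val_Zp_nat //.
  by rewrite mulnAC modnMr.
by exists (exist _ (h i) hz) => //; rewrite inE /= hE dvdn_mulr.
Qed.

(* 'Z_(3 * q) is the ring of residues modulo 3 * q since 3 * q > 1. *)
Theorem theorem3p2 (p q : nat) (hp : p = 3%N) (hq : prime q) (hq3 : (3 < q)%N) :
  energy (line_graph (zero_divisor_graph 'Z_(3 * q))) =
  4 * q%:R - p%:R - 5.
Proof.
have q1 := prime_gt1 hq; have n1 : (1 < 3 * q)%N by lia.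
have mulE (x y : 'Z_(3 * q)) : (x * y == 0) = (3 * q %| x * y)%N.
  by rewrite -val_eqE /=; congr (_ %% _ == _)%N; exact: Zp_cast.
have cop : coprime 3 q by rewrite prime_coprime // dvdn_prime2 // neq_ltn hq3.
have dvdE k : (3 * q %| k)%N = (3 %| k)%N && (q %| k)%N by rewrite Gauss_dvd.
pose V := vertex (zero_divisor_graph 'Z_(3 * q)).
(* If [x * y = 0] with both factors nonzero, each of the primes 3 and [q] divides [x] or [y], but
   neither factor is divisible by both primes; hence exactly one of them divides [x]. *)
have d3 (x : V) : (3 %| val x)%N = ~~ (q %| val x)%N.
  case: x => x /= /andP[x0 /existsP[y /andP[y0]]]; rewrite mulE dvdE => /andP[h3 hq'].
  have ndvd (z : 'Z_(3 * q)) : z != 0 -> ~~ ((3 %| z)%N && (q %| z)%N).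
    apply: contra; rewrite -dvdE => zn; apply/eqP/val_inj => /=.
    have lt_z : (z < 3 * q)%N by rewrite -[X in (_ < X)%N](Zp_cast n1).
    by move: zn; rewrite /dvdn modn_small // => /eqP.
  move: h3 hq' (ndvd _ x0) (ndvd _ y0); rewrite !Euclid_dvdM //.
  by do 4!case: (_ %| _)%N.
pose S := [set x : V | (q %| val x)%N].
have cardS : #|S| = 2%N.
  rewrite /S /V mulnC; exact: card_zero_divisor_multiples.
(* The number [q - 1] is written so that [m = q - 3], which gives the energy [4 * (q - 2)]. *)
have cardT : #|~: S| = (q - 3).+2.
  have -> : ~: S = [set x : V | (3 %| val x)%N] by apply/setP => x; rewrite !inE d3.
  rewrite card_zero_divisor_multiples //; lia.
rewrite (energy_line_graph_K2 _ _ _ cardS cardT).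
  by rewrite hp -[in RHS](subnK (ltnW hq3)) -natr1 natrD; ring.
move=> x y; rewrite !inE /= /zdiv_adj mulE dvdE !Euclid_dvdM // !d3.
case: (eqVneq x y) => [->|_]; first by rewrite addbb.
by do 2!case: (q %| _)%N.
Qed.
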